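(* There is an absolute constant $c>0$ such that for every function $f:\{\pm1\}^n\to\{\pm1\}$, every distribution $\mu$ over $\{\pm1\}^n$, and every $\gamma>0$, $\delta\in(0,1)$, there exists a $(\gamma,d)$-hardcore measure $H$ for $f$ of density $\delta/2$ w.r.t. $\mu$, where \[ d = c\,\frac{\gamma^2}{\log(1/\delta)}\cdot\overline{\mathrm{Depth}}^{\mu}(f,\delta). \]
   Context: A randomized decision tree is a probability distribution over deterministic decision trees (which adaptively query input coordinates and output a label at the leaf reached); the expected depth w.r.t. $\mu$ is the expected number of queries on $\mathbf x\sim\mu$, averaged over the tree's randomness. $\overline{\mathrm{Depth}}^{\mu}(f,\varepsilon)$ is the minimum expected depth w.r.t. $\mu$ of any randomized decision tree $\mathcal T$ with $\Pr_{\mathbf x\sim\mu}[\mathcal T(\mathbf x)\ne f(\mathbf x)]\le\varepsilon$. A function $H:\{\pm1\}^n\to[0,1]$ is a $(\gamma,d)$-hardcore measure for $f$ w.r.t. $\mu$ of density $\delta'$ if (1) $\mathbb{E}_{\mathbf x\sim\mu}[H(\mathbf x)]=\delta'$, and (2) for every decision tree $T:\{\pm1\}^n\to\{\pm1\}$ whose expected depth w.r.t. $\mu$ is at most $d$, $\mathbb{E}_{\mathbf x\sim\mu}[f(\mathbf x)T(\mathbf x)H(\mathbf x)]\le\gamma\,\mathbb{E}_{\mathbf x\sim\mu}[H(\mathbf x)]=\gamma\delta'$ (for randomized $T$ the expectation also ranges over $T$'s randomness).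
   Formalization: The formal theorem assumes Depth^μ(f,δ) > 0 (so d > 0, which forces δ < 1/2); if it is 0 the claim can fail: for f constant and γ = δ = 1/2, d = 0 and the constant tree T = f has E[fTH] = E[H] > γE[H] for every H of density δ/2. *)

(* Defs.v *)
From HB Require Import structures.
From mathcomp Require Import all_boot all_order all_algebra.
From mathcomp Require Import all_classical all_reals all_analysis.

Set Implicit Arguments.
Unset Strict Implicit.
Unset Printing Implicit Defensive.

Import Order.TTheory GRing.Theory Num.Theory.
Local Open Scope ring_scope.
Local Open Scope classical_set_scope.

(* A bit b : bool stands for the sign (-1)^b, so the cube {+1,-1}^n is
   {ffun 'I_n -> bool} and a +/-1-valued function on it is [cube n -> bool]. *)
Definition cube (n : nat) := {ffun 'I_n -> bool}.

Definition sgn {R : realType} (b : bool) : R := (-1) ^+ b.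

(* [Query i t0 t1] reads coordinate i and continues in t1 if the bit is true
   (the sign is -1), in t0 otherwise. *)
Inductive dtree (n : nat) : Type :=
| Leaf of bool
| Query of 'I_n & dtree n & dtree n.

Arguments Leaf {n} _.

Fixpoint dtree_eval n (t : dtree n) (x : cube n) : bool :=
  match t with
  | Leaf b => b
  | Query i t0 t1 => if x i then dtree_eval t1 x else dtree_eval t0 x
  end.

Fixpoint nqueries n (t : dtree n) (x : cube n) : nat :=
  match t with
  | Leaf _ => 0
  | Query i t0 t1 => (if x i then nqueries t1 x else nqueries t0 x).+1
  end.

(* Trees are countable; they carry the discrete sigma-algebra, so that every
   probability distribution over them is a [probability (dtree n) R]. *)
Section DtreeInstances.
Variable n : nat.

Fixpoint dtree_encode (t : dtree n) : GenTree.tree (bool + 'I_n) :=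
  match t with
  | Leaf b => GenTree.Leaf (inl b)
  | Query i t0 t1 =>
      GenTree.Node 0 [:: GenTree.Leaf (inr i); dtree_encode t0; dtree_encode t1]
  end.

Fixpoint dtree_decode (g : GenTree.tree (bool + 'I_n)) : option (dtree n) :=
  match g with
  | GenTree.Leaf (inl b) => Some (Leaf b)
  | GenTree.Node _ [:: GenTree.Leaf (inr i); g0; g1] =>
      match dtree_decode g0, dtree_decode g1 with
      | Some t0, Some t1 => Some (Query i t0 t1)
      | _, _ => None
      end
  | _ => None
  end.

Lemma dtree_encodeK : pcancel dtree_encode dtree_decode.
Proof. by elim=> [//|i t0 IH0 t1 IH1] /=; rewrite IH0 IH1. Qed.

HB.instance Definition _ := Countable.copy (dtree n) (pcan_type dtree_encodeK).
HB.instance Definition _ := isPointed.Build (dtree n) (Leaf false).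
HB.instance Definition _ := @isMeasurable.Build default_measure_display
  (dtree n) discrete_measurable discrete_measurable0
  discrete_measurableC discrete_measurableU.

End DtreeInstances.

Definition is_distribution {R : realType} (T : finType) (mu : T -> R) : Prop :=
  (forall x, 0 <= mu x) /\ \sum_x mu x = 1.

Definition Ex {R : realType} (T : finType) (mu : T -> R) (g : T -> R) : R :=
  \sum_x mu x * g x.

Section DecisionTreeComplexity.
Context {R : realType} (n : nat).
Implicit Types (mu : cube n -> R) (f : cube n -> bool) (H : cube n -> R).
Implicit Type P : probability (dtree n) R.

(* A randomized decision tree is a distribution P over deterministic trees; a
   deterministic tree t is the case P = \d_t. *)
Definition expected_depth mu P : \bar R :=
  'E_P[fun t => Ex mu (fun x => (nqueries t x)%:R)]%E.

Definition error mu f P : \bar R :=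
  'E_P[fun t => Ex mu (fun x => (dtree_eval t x != f x)%:R)]%E.

(* The infimum is attained when 0 <= eps: deleting repeated queries does not
   increase the depth and leaves finitely many trees. *)
Definition Depth mu f (eps : R) : \bar R :=
  ereal_inf [set expected_depth mu P | P in
    [set P : probability (dtree n) R | (error mu f P <= eps%:E)%E]].

(* [d] is an extended real only because [Depth] is; for eps >= 0 the latter is
   between 0 and n. *)
Definition hardcore mu f (gamma : R) (d : \bar R) (delta' : R) H : Prop :=
  [/\ forall x, 0 <= H x <= 1,
      Ex mu H = delta' &
      forall P : probability (dtree n) R, (expected_depth mu P <= d)%E ->
        ('E_P[fun t => Ex mu (fun x => sgn (f x) * sgn (dtree_eval t x) * H x)%R]
           <= (gamma * Ex mu H)%:E)%E].

End DecisionTreeComplexity.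

(* Main.v *)
Require Import Defs.
From mathcomp Require Import all_boot all_order all_algebra.
From mathcomp Require Import all_classical all_reals all_analysis.
From mathcomp Require Import zify ring lra.

Import Order.TTheory GRing.Theory Num.Theory.
Import numFieldNormedType.Exports.
Local Open Scope ring_scope.

(* If no H of density delta/2 is hardcore, then by a minimax argument there is
   one finite multiset of trees whose mean agreement with f is large on every
   such H; hence it is at least some c of order gamma at every point x outside
   a set of mass delta/2.  The majority of O(log(1/delta)/c^2) independent draws
   errs with probability at most delta/2 at each remaining x, so it computes f
   up to error delta, and its expected depth is the number of draws times the
   mean depth of a draw, which is less than Depth mu f delta.

   A randomised tree P violating hardness under the constraint E_P[depth] <= d
   yields a single tree violating it with a penalty gamma * delta / (4 d) per
   unit of depth.  The mean depth of the multiset may then exceed d, say it is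
   kappa * d, but its agreement grows accordingly, c = (gamma / 4)(1 + 2 kappa),
   so fewer draws are needed.  The minimax strategy is built by
   follow-the-regularised-leader, and the draws are derandomised. *)

(** * Finite expectations *)

Section Ex_lemmas.
Context {R : realType} {X : finType} {mu : X -> R}.
Implicit Types g h : X -> R.

Lemma eq_Ex g h : g =1 h -> Ex mu g = Ex mu h.
Proof. by move=> gh; apply: eq_bigr => x _; rewrite gh. Qed.

Lemma ExD g h : Ex mu (fun x => g x + h x) = Ex mu g + Ex mu h.
Proof. by rewrite /Ex -big_split; apply: eq_bigr => x _; rewrite mulrDr. Qed.

Lemma ExZ (a : R) g : Ex mu (fun x => a * g x) = a * Ex mu g.
Proof. by rewrite /Ex mulr_sumr; apply: eq_bigr => x _; rewrite mulrCA. Qed.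

Lemma Ex_sum (T : Type) (r : seq T) (G : T -> X -> R) :
  Ex mu (fun x => \sum_(t <- r) G t x) = \sum_(t <- r) Ex mu (G t).
Proof.
by rewrite /Ex exchange_big; apply: eq_bigr => x _; rewrite mulr_sumr.
Qed.

Hypothesis mu_distr : is_distribution mu.

Lemma Ex_cst (a : R) : Ex mu (fun=> a) = a.
Proof. by rewrite /Ex -mulr_suml mu_distr.2 mul1r. Qed.

Lemma le_Ex {g h} : (forall x, g x <= h x) -> Ex mu g <= Ex mu h.
Proof.
move=> gh; apply: ler_sum => x _; apply: ler_wpM2l => //; exact: mu_distr.1.
Qed.

Lemma Ex_ge0 g : (forall x, 0 <= g x) -> 0 <= Ex mu g.
Proof. by move=> g0; rewrite -(Ex_cst 0); apply: le_Ex. Qed.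

End Ex_lemmas.

(** * Approximate minimax over measures of fixed density *)

Section Minimax.
Context {R : realType} {X : finType}.
Implicit Types (mu H : X -> R) (dl z : R).

Definition density_set mu dl : set (X -> R) :=
  [set H | (forall x, 0 <= H x <= 1) /\ Ex mu H = dl].

Definition clip (z : R) : R := Num.max 0 (Num.min 1 z).

Lemma clip_itv z : 0 <= clip z <= 1.
Proof.
by rewrite /clip le_max lexx ge_max ge_min lexx ler01.
Qed.

Lemma clip_le0 z : z <= 0 -> clip z = 0.
Proof.
move=> z0; rewrite /clip; apply/max_idPl; rewrite ge_min z0 orbT //.
Qed.

Lemma clip_ge1 z : 1 <= z -> clip z = 1.
Proof.
by move=> z1; rewrite /clip (min_idPl z1); apply/max_idPr; rewrite ler01.
Qed.

(** Variational inequality for the nearest point [clip z] of [0,1] to [z]. *)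
Lemma clip_projection z h : 0 <= h <= 1 -> 0 <= (h - clip z) * (clip z - z).
Proof.
move=> /andP[h0 h1]; have [z0|z0] := leP z 0.
  by rewrite clip_le0 //; apply: mulr_ge0; lra.
have [z1|z1] := leP 1 z; first by rewrite clip_ge1 //; apply: mulr_le0; lra.
by rewrite /clip (min_idPr (ltW z1)) (max_idPr (ltW z0)) subrr mulr0.
Qed.

Lemma clip_continuous : continuous clip.
Proof.
move=> z; apply: (@continuous_max _ _ (cst 0)); first exact: cst_continuous.
apply: (@continuous_min _ _ (cst 1) id); [exact: cst_continuous|by move=> ?].
Qed.

Lemma sum_continuous (r : seq X) (F : X -> R -> R) :
  (forall x, continuous (F x)) -> continuous (fun t => \sum_(x <- r) F x t).
Proof.
move=> cF; elim: r => [|x r IH] t.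
  by under eq_fun do rewrite big_nil; exact: cst_continuous.
under eq_fun do rewrite big_cons.
by apply: continuousD; [exact: cF|exact: IH].
Qed.

(* The projection clips a translate of [z]; the translation is chosen by the
   intermediate value theorem so as to give the right density. *)
Lemma density_projection {mu dl} (z : X -> R) : is_distribution mu -> 0 < dl < 1 ->
  exists2 H, density_set mu dl H &
    forall H', density_set mu dl H' ->
      0 <= Ex mu (fun x => (H' x - H x) * (H x - z x)).
Proof.
move=> mud /andP[dl0 dl1].
pose M := \sum_x `|z x|.
have zM x : `|z x| <= M by rewrite /M (bigD1 x) //= lerDl sumr_ge0.
have M0 : 0 <= M by apply: sumr_ge0.
pose F (th : R) := Ex mu (fun x => clip (th + z x)).
have FN : F (- M) = 0.
  rewrite -(Ex_cst mud 0); apply: eq_Ex => x; rewrite clip_le0 //.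
  by have := zM x; rewrite ler_norml => /andP[_]; lra.
have FM : F (1 + M) = 1.
  rewrite -[RHS](Ex_cst mud 1); apply: eq_Ex => x; rewrite clip_ge1 //.
  by have := zM x; rewrite ler_norml => /andP[]; lra.
have cF : continuous F.
  apply: (sum_continuous _ (fun x th => mu x * clip (th + z x))) => x th.
  apply: cvgM; first exact: cvg_cst.
  apply: (@continuous_comp _ _ _ (fun u => u + z x) clip); last exact: clip_continuous.
  by apply: continuousD; [by move=> ?|exact: cst_continuous].
have [||th _ Fth] := @IVT R F (- M) (1 + M) dl _ (continuous_subspaceT cF).
- lra.
- by rewrite FN FM min_l ?max_r ?ler01 // !ltW.
exists (fun x => clip (th + z x)); first by split=> // x; exact: clip_itv.
move=> H' [H'01 EH'].
rewrite [leRHS](_ : _ =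
    Ex mu (fun x => (H' x - clip (th + z x)) * (clip (th + z x) - (th + z x)))).
  by apply: Ex_ge0 => // x; exact: clip_projection.
(* [H'] and the clipped function both have density [dl], so the translation [th] contributes
   nothing. *)
have E0 : Ex mu (fun x => - th * (H' x + (-1) * clip (th + z x))) = 0.
  by rewrite ExZ ExD ExZ -/(F th) EH' Fth mulN1r subrr mulr0.
rewrite -[LHS]addr0 -[X in _ + X = _]E0 -ExD; apply: eq_Ex => x; ring.
Qed.

(* One follow-the-regularised-leader step: [h] minimises the regularised loss
   so far, and [v] is the best response to it. *)
Lemma regularized_step (k G v z h h' : R) : 0 < k -> k * z = - G -> `|v| <= 1 ->
  (G * h + k / 2 * h ^+ 2) + v * h + k * ((h' - h) * (h - z)) - (2 * k)^-1
    <= (v + G) * h' + k / 2 * h' ^+ 2.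
Proof.
move=> k0 kz v1.
have v2 : v ^+ 2 <= 1 by rewrite -real_normK ?num_real // expr_le1.
have -> : G = - (k * z) by rewrite kz opprK.
rewrite -subr_ge0.
(* Completing the square in [h']; the remainder is nonnegative because [|v| <= 1]. *)
have -> : (v + - (k * z)) * h' + k / 2 * h' ^+ 2 -
   (- (k * z) * h + k / 2 * h ^+ 2 + v * h + k * ((h' - h) * (h - z)) - (2 * k)^-1)
  = k / 2 * (h' - h + v / k) ^+ 2 + (1 - v ^+ 2) / (2 * k).
  by field; rewrite gt_eqF.
apply: addr_ge0; last by apply: divr_ge0; [rewrite subr_ge0|rewrite mulr_ge0 // ltW].
by apply: mulr_ge0; [rewrite divr_ge0 // ltW|exact: sqr_ge0].
Qed.

(** Induction on the number of rounds: each new [t] responds to the current minimiser, and strong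
    convexity of the regulariser limits the loss per round to 1/(2k). *)
Lemma regularized_leader {mu dl} {T : Type} {v : T -> X -> R} {cost : T -> R}
    {a : R} (k : R) :
  is_distribution mu -> 0 < dl < 1 -> 0 < k -> (forall t x, `|v t x| <= 1) ->
  (forall H, density_set mu dl H ->
     exists t, a + cost t <= Ex mu (fun x => v t x * H x)) ->
  forall N, exists2 r : seq T, size r = N & forall H, density_set mu dl H ->
    N%:R * (a - (2 * k)^-1) + \sum_(t <- r) cost t
      <= Ex mu (fun x => (\sum_(t <- r) v t x) * H x + k / 2 * H x ^+ 2).
Proof.
move=> mud dl01 k0 v1 best; elim=> [|N [r rN IH]].
  exists [::] => // H _; rewrite big_nil mul0r addr0.
  apply: Ex_ge0 => // x; rewrite big_nil mul0r add0r.
  by rewrite mulr_ge0 ?sqr_ge0 // divr_ge0 // ltW.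
pose G x := \sum_(t <- r) v t x.
(* The minimiser of the regularised loss is the projection of [- G / k]; hence the term with factor
   [k] in [step] has nonnegative mean. *)
have [H HK Hmin] := density_projection (fun x => - G x / k) mud dl01.
have [t tH] := best _ HK.
exists (t :: r) => [|H' H'K]; first by rewrite /= rN.
rewrite big_cons; under eq_Ex do rewrite big_cons.
have IHH := IH _ HK; have HH' := Hmin _ H'K.
have step x : (G x * H x + k / 2 * H x ^+ 2) + v t x * H x
    + k * ((H' x - H x) * (H x - - G x / k)) - (2 * k)^-1
    <= (v t x + G x) * H' x + k / 2 * H' x ^+ 2.
  by apply: regularized_step => //; rewrite mulrC divfK // gt_eqF.
apply: le_trans (le_Ex mud step).
rewrite !ExD !ExZ (Ex_cst mud) -(natr1 N).
rewrite ExD ExZ in IHH.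
have := mulr_ge0 (ltW k0) HH'; lra.
Qed.

(** The gap [a - b = 1/k] is split: one half pays the loss per round, the other, over N >= k^2
    rounds, pays the regulariser, which is at most k/2. *)
Lemma minimax {mu dl} {T : Type} {v : T -> X -> R} {cost : T -> R} {a : R} b :
  is_distribution mu -> 0 < dl < 1 -> (forall t x, `|v t x| <= 1) -> b < a ->
  (forall H, density_set mu dl H ->
     exists t, a + cost t <= Ex mu (fun x => v t x * H x)) ->
  exists2 r : seq T, (0 < size r)%N & forall H, density_set mu dl H ->
    (size r)%:R * b + \sum_(t <- r) cost t
      <= Ex mu (fun x => (\sum_(t <- r) v t x) * H x).
Proof.
move=> mud dl01 v1 ba best.
have k0 : 0 < (a - b)^-1 by rewrite invr_gt0 subr_gt0.
set k := (a - b)^-1 in k0.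
pose N := (Num.truncn (k ^+ 2)).+1.
have [r rN rH] := regularized_leader k mud dl01 k0 v1 best N.
exists r => [|H HK]; first by rewrite rN.
rewrite rN; have := rH _ HK; rewrite ExD ExZ => le1.
have le2 : Ex mu (fun x => H x ^+ 2) <= 1.
  rewrite -[leRHS](Ex_cst mud); apply: le_Ex => // x.
  by have /andP[H0 H1] := HK.1 x; rewrite expr_le1.
have NK : k ^+ 2 <= N%:R by rewrite ltW // truncnS_gt.
have kab : a - b = k^-1 by rewrite invrK.
have le3 : k / 2 <= N%:R * (2 * k)^-1.
  rewrite -subr_ge0 (_ : _ - _ = (N%:R - k ^+ 2) / (2 * k)); last by field; rewrite gt_eqF.
  by rewrite divr_ge0 ?subr_ge0 // mulr_ge0 // ltW.
have le4 : k / 2 * Ex mu (fun x => H x ^+ 2) <= k / 2 by rewrite ler_piMr // divr_ge0 // ltW.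
have le5 : N%:R * (a - (2 * k)^-1) = N%:R * b + N%:R * (2 * k)^-1.
  by rewrite -mulrDr; congr (_ * _); rewrite invfM; lra.
by move: le1 le3 le4; rewrite le5; lra.
Qed.

End Minimax.

(** * Averaging and derandomisation *)

Section Averaging.
Context {R : realType} {T : Type}.

Lemma le_mean (r : seq T) (F : T -> R) b : (0 < size r)%N ->
  \sum_(t <- r) F t <= (size r)%:R * b -> exists t, F t <= b.
Proof.
elim: r => // t r IH _; rewrite big_cons /= -(natr1 (size r)) => le_sum.
have [|bt] := leP (F t) b; first by exists t.
case: (posnP (size r)) => [r0|/IH]; last by apply; lra.
move: le_sum; rewrite (size0nil r0) big_nil /=; lra.
Qed.

(* The method of conditional expectations, for [N] independent uniform draws
   from [r]. *)
Lemma derandomize {X : finType} {r : seq T} {cost : T -> R} {w : T -> X -> R}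
    {good : pred X} {K rho C : R} :
  (0 < size r)%N -> 0 <= C -> 0 <= rho -> (forall t x, 0 <= w t x) ->
  \sum_(t <- r) cost t <= (size r)%:R * K ->
  (forall x, good x -> \sum_(t <- r) w t x <= (size r)%:R * rho) ->
  forall (N : nat) (y : X -> R), (forall x, 0 <= y x) ->
  exists2 s : seq T, size s = N &
    \sum_(t <- s) cost t + C * \sum_(x | good x) y x * \prod_(t <- s) w t x
      <= N%:R * K + C * (rho ^+ N * \sum_(x | good x) y x).
Proof.
move=> r0 C0 rho0 w0 costK wrho; elim=> [|N IH] y y0.
  exists [::] => //; rewrite big_nil mul0r !add0r mul1r.
  by under eq_bigr do rewrite big_nil mulr1.
have [] := @le_mean r (fun t =>
    cost t + C * (rho ^+ N * \sum_(x | good x) y x * w t x))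
    (K + C * (rho ^+ N.+1 * \sum_(x | good x) y x)) r0.
  rewrite big_split /= mulrDr lerD //.
  rewrite -mulr_sumr mulrCA ler_wpM2l // -mulr_sumr exprSr -mulrA mulrCA.
  rewrite ler_wpM2l ?exprn_ge0 // exchange_big /= !mulr_sumr ler_sum // => x gx.
  rewrite -mulr_sumr; apply: le_trans (ler_wpM2l (y0 x) (wrho x gx)) _.
  by rewrite mulrCA (mulrC (y x)).
move=> t tle.
(* The weight of the draw just fixed is absorbed into [y] for the remaining draws. *)
have [x|s sN sle] := IH (fun x => y x * w t x); first exact: mulr_ge0.
exists (t :: s); first by rewrite /= sN.
rewrite big_cons -(natr1 N).
under [X in C * X]eq_bigr do rewrite big_cons mulrA.
lra.
Qed.

End Averaging.

(** * Majority votes *)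

Section Majority.

Definition majority (s : seq bool) : bool := (size s < 2 * count id s)%N.

Lemma majority_neq s b : majority s != b ->
  (count (eq_op^~ b) s <= count (fun c => c != b) s)%N.
Proof.
have -> : count (fun c => c != b) s = (size s - count (eq_op^~ b) s)%N.
  by rewrite -(count_predC (eq_op^~ b) s) addKn.
have := count_predC id s; rewrite /majority; case: ltnP; case: b => // maj size_eq _.
  rewrite (eq_count (a1 := eq_op^~ false) (a2 := predC id)); last by case.
  by move: maj; rewrite -size_eq addnK mul2n -addnn ltn_add2l => /ltnW.
rewrite (eq_count (a2 := id)); last by case.
lia.
Qed.

(** When the majority errs, each factor [q] of a right vote is cancelled by a factor [q^-1] of a
    wrong one. So the product dominates the indicator of an error, and it factors over the votes. *)
Lemma majority_weight {R : realType} (q : R) s b : 0 < q <= 1 ->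
  majority s != b -> 1 <= \prod_(c <- s) (if c == b then q else q^-1).
Proof.
move=> /andP[q0 q1] /majority_neq le_count.
have -> : \prod_(c <- s) (if c == b then q else q^-1)
    = q ^+ count (eq_op^~ b) s * q^-1 ^+ count (fun c => c != b) s.
  elim: s {le_count} => [|c s IH]; first by rewrite big_nil mulr1.
  rewrite big_cons IH /=; case: eqP => _ /=.
    by rewrite add0n add1n exprS mulrA.
  by rewrite add0n add1n exprS mulrCA.
have q1' : 1 <= q^-1 by rewrite invf_ge1.
apply: le_trans (ler_wpM2l _ (ler_weXn2l q1' le_count)).
  by rewrite exprVn divff // expf_neq0 // gt_eqF.
by rewrite exprn_ge0 // ltW.
Qed.

End Majority.

(** * Running several trees in sequence *)

Section Composition.
Context {n : nat}.
Implicit Types (t : dtree n) (s : seq (dtree n)) (x : cube n).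

Fixpoint graft t (k : bool -> dtree n) : dtree n :=
  match t with
  | Leaf b => k b
  | Query i t0 t1 => Query i (graft t0 k) (graft t1 k)
  end.

(** Repeated queries are not shared, so that query counts add up exactly. *)
Fixpoint combine (g : seq bool -> bool) s : dtree n :=
  match s with
  | [::] => Leaf (g [::])
  | t :: s' => graft t (fun b => combine (fun l => g (b :: l)) s')
  end.

Lemma graft_eval t k x :
  dtree_eval (graft t k) x = dtree_eval (k (dtree_eval t x)) x.
Proof. by elim: t => //= i t0 IH0 t1 IH1; case: ifP. Qed.

Lemma graft_nqueries t k x :
  nqueries (graft t k) x = (nqueries t x + nqueries (k (dtree_eval t x)) x)%N.
Proof. by elim: t => //= i t0 IH0 t1 IH1; case: ifP => _; rewrite ?IH0 ?IH1. Qed.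

Lemma combine_eval g s x :
  dtree_eval (combine g s) x = g [seq dtree_eval t x | t <- s].
Proof. by elim: s g => //= t s IH g; rewrite graft_eval IH. Qed.

Lemma combine_nqueries g s x :
  nqueries (combine g s) x = (\sum_(t <- s) nqueries t x)%N.
Proof.
by elim: s g => /= [|t s IH] g; rewrite (big_nil, big_cons) // graft_nqueries IH.
Qed.

Lemma exact_tree (f : cube n -> bool) : exists t, dtree_eval t =1 f.
Proof.
exists (combine (fun l => f [ffun i : 'I_n => nth false l i])
          [seq Query i (Leaf false) (Leaf true) | i <- enum 'I_n]) => x.
rewrite combine_eval -map_comp; congr f; apply/ffunP => i; rewrite ffunE.
by rewrite (nth_map i) ?size_enum_ord // nth_ord_enum /=; case: (x i).
Qed.

End Composition.

(** A bad set of mass [m > dl] would carry a measure of density [dl], namely [dl / m] times its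
    indicator, whose correlation with [g] is too small. *)
Lemma low_correlation_mass {R : realType} {X : finType} {mu : X -> R} {dl : R}
    {g : X -> R} {c : R} :
  is_distribution mu -> 0 < dl ->
  (forall H, density_set mu dl H -> c * dl <= Ex mu (fun x => g x * H x)) ->
  \sum_(x | g x < c) mu x <= dl.
Proof.
move=> mud dl0 corr; rewrite leNgt; apply/negP => big_bad.
set m := \sum_(x | g x < c) mu x in big_bad.
have m0 : 0 < m by apply: lt_trans big_bad.
pose H x := if g x < c then dl / m else 0.
have HK : density_set mu dl H.
  split=> [x|].
    rewrite /H; case: ifP => _; last by rewrite lexx ler01.
    by rewrite ler_pdivlMr // mul0r ler_pdivrMr // mul1r !ltW.
  rewrite /Ex; under eq_bigr do rewrite /H (fun_if ( *%R _)) mulr0.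
  by rewrite -big_mkcond -mulr_suml -/m mulrCA divff ?mulr1 // gt_eqF.
have term0 x : 0 <= mu x * ((c + -1 * g x) * H x).
  apply: mulr_ge0; first exact: mud.1.
  rewrite /H; case: ifP => gx; last by rewrite mulr0.
  by apply: mulr_ge0; [lra|rewrite divr_ge0 // ltW].
have sum0 : Ex mu (fun x => (c + -1 * g x) * H x) = 0.
  apply/le_anti/andP; split; last by apply: sumr_ge0.
  under eq_Ex do rewrite mulrDl -mulrA.
  by rewrite ExD !ExZ HK.2 mulN1r subr_le0; exact: corr.
move: (m0); rewrite {1}/m big1 ?ltxx // => x gx.
have /eqP : mu x * ((c + -1 * g x) * H x) = 0.
  by apply: (psumr_eq0P _ sum0) => // z _; exact: term0.
rewrite /H gx mulf_eq0 => /orP[/eqP //|].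
by rewrite mulf_eq0 (gt_eqF (divr_gt0 dl0 m0)) orbF => /eqP; lra.
Qed.

(** * Boosting a weak correlation to a small error *)

Section Boosting.
Context {R : realType} {n : nat}.
Implicit Types (mu : cube n -> R) (f : cube n -> bool) (t : dtree n) (x : cube n).

Definition depth mu t : R := Ex mu (fun x => (nqueries t x)%:R).

Definition agreement f t x : R := sgn (f x) * sgn (dtree_eval t x).

Definition error_rate mu f t : R :=
  Ex mu (fun x => (dtree_eval t x != f x)%:R).

Lemma agreementE f t x : agreement f t x = if dtree_eval t x == f x then 1 else -1.
Proof.
rewrite /agreement /sgn; case: (f x) (dtree_eval t x) => -[];
  rewrite /= ?expr1 ?expr0; lra.
Qed.

Lemma norm_agreement f t x : `|agreement f t x| = 1.
Proof. by rewrite agreementE; case: ifP; rewrite ?normrN normr1. Qed.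

Lemma depth_ge0 {mu} t : is_distribution mu -> 0 <= depth mu t.
Proof. by move=> mud; apply: Ex_ge0. Qed.

Lemma depth_combine mu g (s : seq (dtree n)) :
  depth mu (combine g s) = \sum_(t <- s) depth mu t.
Proof.
by rewrite -Ex_sum; apply: eq_Ex => x; rewrite combine_nqueries natr_sum.
Qed.

(* With [q = 1 - c / 2]; the sum is over a uniform multiset of trees whose mean
   agreement with [f] at [x] is at least [c]. *)
Lemma mean_majority_weight (r : seq (dtree n)) f x (c : R) : 0 < c <= 1 ->
  (size r)%:R * c <= \sum_(t <- r) agreement f t x ->
  \sum_(t <- r) (if dtree_eval t x == f x then 1 - c / 2 else (1 - c / 2)^-1)
    <= (size r)%:R * (1 - c ^+ 2 / 4).
Proof.
move=> /andP[c0 c1] corr; set q := 1 - c / 2.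
have q0 : 0 < q by rewrite /q; lra.
(* As the agreement is 1 or -1, the weight is an affine function of it. *)
have -> : \sum_(t <- r) (if dtree_eval t x == f x then q else q^-1)
    = (size r)%:R * ((q + q^-1) / 2) - (q^-1 - q) / 2 * \sum_(t <- r) agreement f t x.
  rewrite -sum1_size natr_sum mulr_suml mulr_sumr -sumrB; apply: eq_bigr => t _.
  by rewrite agreementE; case: ifP => _; lra.
have qV : 0 <= (q^-1 - q) / 2.
  by rewrite divr_ge0 // subr_ge0 (@le_trans _ _ 1) ?invf_ge1 // /q; lra.
have := ler_wpM2l qV corr.
suff : (size r)%:R * ((q + q^-1) / 2 - (q^-1 - q) / 2 * c) <= (size r)%:R * (1 - c ^+ 2 / 4).
  lra.
apply: ler_wpM2l => //; rewrite -subr_ge0.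
have -> : 1 - c ^+ 2 / 4 - ((q + q^-1) / 2 - (q^-1 - q) / 2 * c) = (c / 2) ^+ 2 / (2 * q).
  have -> : c = 2 * (1 - q) by rewrite /q; lra.
  by field; rewrite gt_eqF.
by rewrite divr_ge0 ?sqr_ge0 // mulr_ge0 // ltW.
Qed.

(** By 1 - y <= exp(-y) the power is at most delta^3, and delta^2 <= 1/4. *)
Lemma exp_decay (c delta : R) (N : nat) : 0 < c <= 1 -> 0 < delta < 1 / 2 ->
  12 * ln delta^-1 <= N%:R * c ^+ 2 -> (1 - c ^+ 2 / 4) ^+ N <= delta / 4.
Proof.
move=> /andP[c0 c1] /andP[d0 d1] NL.
have c21 : c ^+ 2 <= 1 by rewrite expr_le1 // ltW.
apply: (@le_trans _ _ (expR (- (c ^+ 2 / 4)) ^+ N)).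
  by apply: lerXn2r; rewrite ?nnegrE ?expR_ge0 //; [lra|exact: expR_ge1Dx].
rewrite -expRM_natl.
apply: (@le_trans _ _ (expR (3%:R * ln delta))).
  by rewrite ler_expR; rewrite lnV ?posrE // in NL; lra.
rewrite expRM_natl lnK ?posrE // exprS mulrC.
have : delta ^+ 2 <= (1 / 2) ^+ 2 by rewrite lerXn2r // ?nnegrE; lra.
by move=> d2; rewrite mulrC ler_pM2l //; lra.
Qed.

Lemma boosted_tree {mu f} {gamma delta d : R} :
  is_distribution mu -> 0 < gamma -> 0 < delta < 1 / 2 -> 0 < d ->
  (forall H, density_set mu (delta / 2) H -> exists t,
     gamma * delta / 4 + gamma * delta / (4 * d) * depth mu t
       <= Ex mu (fun x => agreement f t x * H x)) ->
  exists t, depth mu t <= 224 * (ln delta^-1 / gamma ^+ 2) * d /\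
    error_rate mu f t <= delta.
Proof.
move=> mud g0 /andP[dl0 dl1] d0 weak.
have dl01 : 0 < delta / 2 < 1 by lra.
have agr1 t x : `|agreement f t x| <= 1 by rewrite norm_agreement.
(* Half of the advantage is given up to the approximate minimax. *)
have ba : gamma * delta / 8 < gamma * delta / 4.
  by have := mulr_gt0 g0 dl0; lra.
have [r r0 corr] := minimax _ mud dl01 agr1 ba weak.
set S : R := (size r)%:R in corr.
have S0 : 0 < S by rewrite ltr0n.
pose kappa := (\sum_(t <- r) depth mu t) / (S * d).
have kappa0 : 0 <= kappa.
  rewrite divr_ge0 ?sumr_ge0 // => [t _|]; first exact: depth_ge0.
  by rewrite mulr_ge0 // ltW.
have depthE : \sum_(t <- r) depth mu t = S * (kappa * d).
  by rewrite /kappa; field; rewrite !gt_eqF.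
(* [c] is fitted so that [S * c * (delta / 2)] is the guaranteed S gamma delta / 8 plus the total
   depth penalty S kappa gamma delta / 4. *)
pose u := 1 + 2 * kappa.
have u1 : 1 <= u by rewrite /u; lra.
have u0 : 0 < u by apply: lt_le_trans u1.
pose c := gamma / 4 * u.
have c0 : 0 < c by rewrite mulr_gt0 ?divr_gt0.
have corr_c H : density_set mu (delta / 2) H ->
    S * c * (delta / 2) <= Ex mu (fun x => (\sum_(t <- r) agreement f t x) * H x).
  move=> HK; apply: le_trans (corr H HK); rewrite -mulr_sumr depthE.
  rewrite le_eqVlt; apply/orP; left; apply/eqP; rewrite /c /u.
  by field; rewrite gt_eqF.
have aggr_le x : \sum_(t <- r) agreement f t x <= S.
  rewrite /S -sum1_size natr_sum ler_sum // => t _.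
  by have := agr1 t x; rewrite ler_norml => /andP[].
(* Tested on the constant measure [delta / 2], since the mean agreement never exceeds 1. *)
have c1 : c <= 1.
  have constK : density_set mu (delta / 2) (fun=> delta / 2).
    by split; [move=> _; lra|exact: Ex_cst].
  have := corr_c _ constK.
  have le_S : Ex mu (fun x => (\sum_(t <- r) agreement f t x) * (delta / 2))
      <= S * (delta / 2).
    by rewrite -(Ex_cst mud (S * _)); apply: le_Ex => // x; rewrite ler_wpM2r ?aggr_le //; lra.
  move/le_trans/(_ le_S); rewrite ler_pM2r; last by lra.
  by rewrite -{2}(mulr1 S) ler_pM2l.
have c01 : 0 < c <= 1 by rewrite c0.
have bad := low_correlation_mass mud (proj1 (andP dl01)) corr_c.
pose L := ln delta^-1.
(* This lets 2L/c^2 absorb the rounding up in [N], whence 14 = 12 + 2. *)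
have L2 : 1 / 2 <= L.
  have : ln (1 + - (1 / 2)) <= - (1 / 2) :> R by apply: le_ln1Dx; lra.
  have : ln delta <= ln (1 + - (1 / 2)) by rewrite ler_ln ?posrE //; lra.
  by rewrite /L lnV ?posrE //; lra.
have L0 : 0 < L by apply: lt_le_trans L2; rewrite divr_gt0.
pose N := (Num.truncn (12 * L / c ^+ 2)).+1.
have c20 : 0 < c ^+ 2 by rewrite exprn_gt0.
have c21 : c ^+ 2 <= 1 by rewrite expr_le1 // ltW.
have NL : 12 * L <= N%:R * c ^+ 2 by rewrite -ler_pdivrMr // ltW // truncnS_gt.
have NU : N%:R <= 14 * L / c ^+ 2.
  have : 1 <= 2 * L / c ^+ 2.
    by rewrite ler_pdivlMr // mul1r; lra.
  have /truncn_itv/andP[] : 0 <= 12 * L / c ^+ 2 by rewrite ltW // divr_gt0 // mulr_gt0.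
  by rewrite /N -natr1; lra.
(* [M] is at least twice the mean depth of [N] draws, as 2 kappa <= u. With weight 2M/delta on the
   error, the single bound [M] on the sum yields both depth at most [M] and error at most delta/2 on
   good points. *)
pose M := N%:R * (u * d).
have M0 : 0 < M by rewrite !mulr_gt0 ?ltr0n.
pose w t x := if dtree_eval t x == f x then 1 - c / 2 else (1 - c / 2)^-1.
have q0 : 0 < 1 - c / 2 by lra.
have w0 t x : 0 <= w t x by rewrite /w; case: ifP => _; rewrite ?invr_ge0 ltW.
have rho0 : 0 <= 1 - c ^+ 2 / 4 by lra.
pose good := [pred x | S * c <= \sum_(t <- r) agreement f t x].
have C0 : 0 < 2 * M / delta by rewrite divr_gt0 // mulr_gt0.
have [||s sN sle] := derandomize (K := kappa * d) (cost := depth mu)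
  (good := good) r0 (ltW C0) rho0 w0 _ _ N mu mud.1.
- by rewrite depthE.
- by move=> x; exact: mean_majority_weight.
set E := \sum_(x | good x) mu x * \prod_(t <- s) w t x in sle.
have E0 : 0 <= E.
  by apply: sumr_ge0 => x _; rewrite mulr_ge0 ?mud.1 // prodr_ge0.
have D0 : 0 <= \sum_(t <- s) depth mu t by apply: sumr_ge0 => t _; exact: depth_ge0.
have good1 : \sum_(x | good x) mu x <= 1.
  rewrite -mud.2 [leRHS](bigID good) /= lerDl sumr_ge0 // => x _; exact: mud.1.
have {sle} sle : \sum_(t <- s) depth mu t + 2 * M / delta * E <= M.
  apply: le_trans sle _.
  have : (1 - c ^+ 2 / 4) ^+ N * \sum_(x | good x) mu x <= delta / 4.
    apply: le_trans (exp_decay _ _ _ c01 _ NL); last by rewrite dl0.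
    by rewrite ler_piMr // exprn_ge0.
  move/(ler_wpM2l (ltW C0)).
  have -> : 2 * M / delta * (delta / 4) = M / 2 by field; rewrite gt_eqF.
  have : N%:R * (kappa * d) <= M / 2.
    by rewrite /M -mulrA ler_wpM2l // /u; lra.
  by move=> le1 le2; rewrite [leRHS]splitr lerD.
exists (combine majority s); split.
  rewrite depth_combine; apply: (@le_trans _ _ M).
    by apply: le_trans sle; rewrite lerDl mulr_ge0 // ltW.
  (* 224 = 14 * 16, since c^2 = gamma^2 u^2 / 16; a factor [u >= 1] is left over. *)
  have -> : 224 * (L / gamma ^+ 2) * d = 14 * L / c ^+ 2 * (u * d) * u.
    by rewrite /c; field; rewrite !gt_eqF.
  have ud0 : 0 <= u * d by rewrite mulr_ge0 // ltW.
  apply: (@le_trans _ _ (14 * L / c ^+ 2 * (u * d))); first exact: ler_wpM2r.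
  by rewrite ler_peMr // mulr_ge0 // divr_ge0 ?mulr_ge0 // ltW.
have E_le : E <= delta / 2.
  have : 2 * M / delta * E <= 2 * M / delta * (delta / 2).
    have -> : 2 * M / delta * (delta / 2) = M by field; rewrite gt_eqF.
    by apply: le_trans sle; rewrite lerDr.
  by rewrite ler_pM2l.
(* Half of [delta] covers the bad points, all counted as errors, and half the good ones. *)
rewrite /error_rate /Ex (bigID good) /= addrC (splitr delta).
apply: lerD.
  apply: le_trans bad; under [leRHS]eq_bigl do rewrite ltNge.
  by apply: ler_sum => x _; rewrite ler_piMr ?mud.1 // lern1 leq_b1.
apply: le_trans E_le; apply: ler_sum => x _; apply: ler_wpM2l; first exact: mud.1.
rewrite combine_eval; case: (boolP (_ != _)) => [|_]; last by apply: prodr_ge0.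
have q01 : 0 < 1 - c / 2 <= 1 by lra.
by move=> /(majority_weight _ _ _ q01); rewrite big_map.
Qed.

End Boosting.

(** * Randomised trees and [Depth] *)

Section RandomizedTrees.
Context {R : realType} {n : nat}.
Implicit Types (mu : cube n -> R) (f : cube n -> bool) (t : dtree n).
Implicit Types (P : probability (dtree n) R) (F G : dtree n -> R).

Lemma expectation_dirac t F : 'E_(\d_t : probability (dtree n) R)[F]%E = (F t)%:E.
Proof.
by rewrite unlock integral_dirac // diracT mul1e.
Qed.

(* A constraint on an expectation is turned into a penalty, so that a single
   tree in the support can be found. *)
Lemma penalized_tree {P F G} {B a d lam : R} : (forall t, `|F t| <= B) ->
  (forall t, 0 <= G t) -> 0 <= lam -> ('E_P[G] <= d%:E)%E -> (a%:E < 'E_P[F])%E ->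
  exists t, a - lam * d + lam * G t <= F t.
Proof.
move=> FB G0 lam0 Gd aF; apply: contrapT => noT.
have FG t : F t <= a - lam * d + lam * G t.
  by rewrite leNgt; apply/negP => lt; apply: noT; exists t; exact: ltW.
have intF : P.-integrable setT (EFin \o F).
  apply: measurable_bounded_integrable => //.
    by rewrite (le_lt_trans (probability_le1 _ _)) // ltry.
  exists B; split; first exact: num_real.
  by move=> M BM t _; exact: le_trans (FB t) (ltW BM).
(* [G] may be unbounded; its integrability comes from the finite bound [d] on its mean. *)
have intG : P.-integrable setT (EFin \o G).
  apply/integrableP; split=> //.
  under eq_integral do rewrite /= ger0_norm //.
  by move: Gd; rewrite unlock => /le_lt_trans; apply; rewrite ltry.
have intc : P.-integrable setT (EFin \o cst (a - lam * d)).
  exact: finite_measure_integrable_cst.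
have intlG : P.-integrable setT (EFin \o (lam \o* G)).
  have := integrableZl measurableT lam intG; congr (P.-integrable _ _).
  by apply/funext => t /=; rewrite mulrC EFinM.
suff : ('E_P[F] <= a%:E)%E by rewrite leNgt aF.
apply: (@le_trans _ _ (expectation P (cst (a - lam * d) \+ (lam \o* G)))).
  rewrite unlock; apply: le_integral => //.
    by have := integrableD measurableT intc intlG.
  by move=> t _; rewrite lee_fin /= [G t * lam]mulrC FG.
rewrite expectationD; [|exact/Lfun1_integrable..].
rewrite expectationZl; last exact/Lfun1_integrable.
rewrite expectation_cst.
apply: (@le_trans _ _ ((a - lam * d)%:E + lam%:E * d%:E)%E).
  by rewrite leeD2l // lee_wpmul2l // lee_fin.
by rewrite -EFinM -EFinD subrK.
Qed.

Lemma Depth_le {mu f} {eps : R} {t} :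
  error_rate mu f t <= eps -> (Depth mu f eps <= (depth mu t)%:E)%E.
Proof.
move=> err; apply: ereal_inf_lbound; exists \d_t => /=.
  by rewrite /error expectation_dirac lee_fin.
by rewrite /expected_depth expectation_dirac.
Qed.

(** The two constant trees make no query and their error rates sum to 1. *)
Lemma Depth_half {mu f} {eps : R} : is_distribution mu -> 1 / 2 <= eps ->
  (Depth mu f eps <= 0)%E.
Proof.
move=> mud eps2.
have leaf b : error_rate mu f (Leaf b) <= eps -> (Depth mu f eps <= 0)%E.
  move=> /Depth_le; rewrite /depth /=; congr (_ <= _%:E)%E.
  by rewrite -[RHS](Ex_cst mud).
have : error_rate mu f (Leaf false) + error_rate mu f (Leaf true) = 1.
  rewrite -ExD -[RHS](Ex_cst mud); apply: eq_Ex => x /=.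
  by case: (f x); rewrite /= ?addr0 ?add0r.
move=> sum1; have [/leaf //|lt0] := leP (error_rate mu f (Leaf false)) eps.
by apply: (leaf true); lra.
Qed.

Lemma Depth_lty {mu f} {eps : R} : 0 <= eps -> (Depth mu f eps < +oo)%E.
Proof.
move=> eps0; have [t tf] := exact_tree f.
apply: (@le_lt_trans _ _ (depth mu t)%:E); last exact: ltry.
apply: Depth_le; rewrite /error_rate /Ex big1 // => x _.
by rewrite tf eqxx mulr0.
Qed.

End RandomizedTrees.

(* When Depth mu f delta = 0 the bound on the depth is 0 and the claim fails:
   for constant f and gamma < 1 the constant tree has correlation 1 with f on
   every H. *)
Theorem theorem5p2 (R : realType) :
  exists c : R, 0 < c /\
    forall (n : nat) (f : cube n -> bool) (mu : cube n -> R) (gamma delta : R),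
      is_distribution mu -> 0 < gamma -> 0 < delta -> delta < 1 ->
      (0 < Depth mu f delta)%E ->
      exists H : cube n -> R,
        hardcore mu f gamma
          ((c * (gamma ^+ 2 / ln (delta^-1)))%:E * Depth mu f delta)%E
          (delta / 2) H.
Proof.
(* Just below 1/224, so that the tree from [boosted_tree] is strictly shallower than [Depth]. *)
exists (1 / 225); split=> [|n f mu gamma delta mud g0 dl0 dl1 Dpos]; first by lra.
have dl2 : delta < 1 / 2.
  by rewrite ltNge; apply/negP => /(Depth_half mud) D0; move: Dpos; rewrite ltNge D0.
have Dfin : Depth mu f delta \is a fin_num.
  by rewrite ge0_fin_numE ?Depth_lty // ltW.
move: (Dfin) Dpos => /fineK <-; set D := fine _; rewrite lte_fin -EFinM => D0.
have L0 : 0 < ln delta^-1 by rewrite ln_gt0 // invf_gt1.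
set d := _ * D.
have d0 : 0 < d by rewrite !mulr_gt0 ?invr_gt0 ?exprn_gt0.
apply: contrapT => noH.
have [||t [depth_t err_t]] := @boosted_tree R n mu f gamma delta d mud g0 _ d0.
- by rewrite dl0.
- move=> H [H01 EH]; apply: contrapT => noT; apply: noH; exists H; split=> // P Pd.
  rewrite leNgt; apply/negP => corr.
  have F1 t : `|Ex mu (fun x => agreement f t x * H x)| <= 1.
    apply: le_trans (ler_norm_sum _ _ _) _; rewrite -mud.2 ler_sum // => x _.
    rewrite normrM (ger0_norm (mud.1 x)) ler_piMr ?mud.1 // normrM norm_agreement mul1r.
    by have /andP[H0 H1] := H01 x; rewrite ger0_norm.
  (* This penalty rate times [d] is half of the violated bound gamma * delta / 2; the other half is
     the advantage left. *)
  have lam0 : 0 <= gamma * delta / (4 * d).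
    by rewrite ltW // divr_gt0 // mulr_gt0.
  have [t tle] := penalized_tree F1 (fun t => depth_ge0 t mud) lam0 Pd corr.
  apply: noT; exists t; apply: le_trans tle; rewrite lerD2r EH le_eqVlt.
  by apply/orP; left; apply/eqP; field; rewrite gt_eqF.
- have := Depth_le err_t; rewrite -(fineK Dfin) lee_fin -/D.
  move=> /le_trans/(_ depth_t); apply/negP; rewrite -ltNge.
  rewrite (_ : _ * d = 224 / 225 * D); first by lra.
  by rewrite /d; field; rewrite !gt_eqF.
Qed.
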